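(* For every $\varepsilon>0$ there is a constant $C(\varepsilon)>0$ such that for each $m\in\mathbb N$, \[\mathrm{BH}^{\mathrm{pol}}_{\ell_{\frac{2m}{m+1},1}}(m)\le C(\varepsilon)(\sqrt2+\varepsilon)^m.\]
   Context: $\mathcal J(m,n)=\{(j_1,\dots,j_m):1\le j_1\le\dots\le j_m\le n\}$; every $m$-homogeneous polynomial on $\mathbb C^n$ is uniquely $P(z)=\sum_{\mathbf j\in\mathcal J(m,n)}c_{\mathbf j}z_{j_1}\cdots z_{j_m}$, and $\|P\|_\infty=\sup_{\|z\|_\infty\le1}|P(z)|$. For finite $I$ and $1<p<\infty$, $\|x\|_{\ell_{p,1}(I)}=\sum_k x_k^*(k^{1/p}-(k-1)^{1/p})$, $x^*$ the non-increasing rearrangement of $(|x_i|)$. $\mathrm{BH}^{\mathrm{pol}}_{X}(m)$ is the best constant $C\ge1$ such that $\|(c_{\mathbf j})_{\mathbf j\in\mathcal J(m,n)}\|_{X}\le C\|P\|_\infty$ for all $n$ and all $m$-homogeneous polynomials $P$ on $\mathbb C^n$. *)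

(* Defs.v *)
From HB Require Import structures.
From mathcomp Require Import all_boot all_order all_algebra.
From mathcomp Require Import all_classical all_reals all_analysis.
From mathcomp Require Import complex.
Set Implicit Arguments. Unset Strict Implicit. Unset Printing Implicit Defensive.
Import Order.TTheory GRing.Theory Num.Theory.
Local Open Scope ring_scope.
Local Open Scope classical_set_scope.

Section Defs.
Variable R : realType.

Definition cmod (z : R[i]) : R := Num.sqrt (complex.Re z ^+ 2 + complex.Im z ^+ 2).

Definition inJ (m n : nat) (j : m.-tuple 'I_n) : bool := sorted (fun a b : 'I_n => a <= b)%N j.

(* an m-homogeneous polynomial on C^n, given by its coefficients (c_j)_{j in J(m,n)}
   (values of c outside J(m,n) are irrelevant), evaluated at z *)
Definition hpoly_eval (m n : nat) (c : m.-tuple 'I_n -> R[i]) (z : 'I_n -> R[i]) : R[i] :=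
  \sum_(j : m.-tuple 'I_n | inJ j) c j * \prod_(k < m) z (tnth j k).

Definition supnorm (m n : nat) (c : m.-tuple 'I_n -> R[i]) : R :=
  sup [set cmod (hpoly_eval c z) | z in [set z : 'I_n -> R[i] | forall i, cmod (z i) <= 1]].

(* Lorentz norm ||x||_{l_{p,1}(I)} = sum_k x*_k (k^{1/p} - (k-1)^{1/p}) of a finite family
   given as a list of its moduli; x* = non-increasing rearrangement. *)
Definition lorentz_p1 (p : R) (s : seq R) : R :=
  let xs := sort (fun a b : R => b <= a) s in
  \sum_(k < size xs) nth 0 xs k * (((k.+1)%:R : R) `^ p^-1 - ((k%:R : R) `^ p^-1)).

Definition coef_lorentz (p : R) (m n : nat) (c : m.-tuple 'I_n -> R[i]) : R :=
  lorentz_p1 p [seq cmod (c j) | j <- enum (fun j : m.-tuple 'I_n => inJ j)].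

(* BH^pol_{l_{p,1}}(m): best constant C >= 1 with ||c||_{l_{p,1}} <= C ||P||_oo for all n, P;
   as an extended real infimum (+oo if no such constant exists). *)
Definition BHpol_lorentz (p : R) (m : nat) : \bar R :=
  ereal_inf [set C%:E | C in [set C : R | 1 <= C /\
     forall (n : nat) (c : m.-tuple 'I_n -> R[i]), coef_lorentz p c <= C * supnorm c]].

End Defs.

(* Main.v *)
Require Import Defs.
From HB Require Import structures.
From mathcomp Require Import all_boot all_order all_algebra.
From mathcomp Require Import all_classical all_reals all_analysis.
From mathcomp Require Import complex.
From mathcomp Require Import cyclic separable cyclotomic.
From mathcomp Require Import ring lra.
Set Implicit Arguments. Unset Strict Implicit. Unset Printing Implicit Defensive.
Import Order.TTheory GRing.Theory Num.Theory.
Local Open Scope ring_scope.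

(** Two estimates are combined; both lose only a factor polynomial in m.

    Lorentz norm versus mixed norms. Enumerate the coefficients by decreasing
    modulus and give the N-th index the mass N^(1/m) - (N-1)^(1/m). By a
    Loomis-Whitney count, at most half of the first N indices are bad, i.e. have
    in every direction k a slice {j_k = i} whose mass up to then exceeds 2. So
    the bad indices carry at most half of the Lorentz sum. For the others
    Cauchy-Schwarz on a slice of mass at most 2 bounds the sum by
    sum_k sum_i (sum_{j_k = i} |c_j|^2)^(1/2), up to 2 sqrt(2m).

    Mixed norms versus the sup norm. These sums are at most sum_i ||z_i dP/dz_i||_2,
    and the L1-L2 inequality on the polytorus, with constant sqrt 2 per degree,
    reduces them to sup_z sum_i |z_i dP/dz_i|, which is at most e m ||P||. In one
    variable that inequality is sum_k 2^-k |a_k|^2 <= ||f||_1^2: reflect the zeros of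
    f lying in the disc, approximate the result by the square of a polynomial g,
    and apply Cauchy-Schwarz to the coefficients of g^2. *)

(** * Modulus and Parseval's identity *)

Section Modulus.
Context {R : realType}.
Implicit Types (x y z : R[i]).

Lemma cmod_norm z : ((cmod z)%:C)%C = `|z|.
Proof. by rewrite normc_def. Qed.

Lemma cmod_ge0 z : 0 <= cmod z.
Proof. exact: sqrtr_ge0. Qed.

Lemma cmod0 : cmod (0 : R[i]) = 0.
Proof. by apply: complexI; rewrite cmod_norm normr0. Qed.

Lemma cmod1 : cmod (1 : R[i]) = 1.
Proof. by apply: complexI; rewrite cmod_norm normr1. Qed.

Lemma cmodN z : cmod (- z) = cmod z.
Proof. by apply: complexI; rewrite !cmod_norm normrN. Qed.

Lemma cmodM x y : cmod (x * y) = cmod x * cmod y.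
Proof. by apply: complexI; rewrite rmorphM /= !cmod_norm normrM. Qed.

Lemma cmodX x k : cmod (x ^+ k) = cmod x ^+ k.
Proof. by apply: complexI; rewrite rmorphXn /= !cmod_norm normrX. Qed.

Lemma cmodV x : cmod x^-1 = (cmod x)^-1.
Proof. by apply: complexI; rewrite fmorphV /= !cmod_norm normfV. Qed.

Lemma cmod_eq0 x : (cmod x == 0) = (x == 0).
Proof. by rewrite -(inj_eq (@complexI R)) cmod_norm normr_eq0. Qed.

Lemma cmod_real (a : R) : cmod (a%:C)%C = `|a|.
Proof. by rewrite /cmod /= expr0n addr0 sqrtr_sqr. Qed.

Lemma ler_cmodD x y : cmod (x + y) <= cmod x + cmod y.
Proof. by rewrite -lecR rmorphD /= !cmod_norm ler_normD. Qed.

Lemma cmod_prod (I : Type) (r : seq I) (P : pred I) (F : I -> R[i]) :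
  cmod (\prod_(i <- r | P i) F i) = \prod_(i <- r | P i) cmod (F i).
Proof. exact: (big_morph _ cmodM cmod1). Qed.

Lemma ler_cmod_sum (I : Type) (r : seq I) (P : pred I) (F : I -> R[i]) :
  cmod (\sum_(i <- r | P i) F i) <= \sum_(i <- r | P i) cmod (F i).
Proof.
elim/big_rec2: _ => [|i a b _ le_ba]; first by rewrite cmod0.
by rewrite (le_trans (ler_cmodD _ _)) // lerD2l.
Qed.

Lemma cmod_sqr z : cmod z ^+ 2 = complex.Re z ^+ 2 + complex.Im z ^+ 2.
Proof. by rewrite sqr_sqrtr // addr_ge0 ?sqr_ge0. Qed.

Lemma cmod_sqrC z : ((cmod z ^+ 2)%:C)%C = z * (z^*)%C.
Proof. by rewrite rmorphXn /= cmod_norm sqr_normc. Qed.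

Lemma cmod_conj z : cmod (z^*)%C = cmod z.
Proof. by apply: complexI; rewrite !cmod_norm normcJ. Qed.

Lemma conj_unimodular z : cmod z = 1 -> (z^*)%C = z^-1.
Proof.
move=> z1; have zz : z * (z^*)%C = 1 by rewrite -cmod_sqrC z1 expr1n.
have z0 : z != 0 by rewrite -cmod_eq0 z1 oner_eq0.
by apply: (mulfI z0); rewrite zz divff.
Qed.

Lemma cmod_unity_root N z : (0 < N)%N -> z ^+ N = 1 -> cmod z = 1.
Proof.
move=> N0 zN; apply/eqP; rewrite -(@pexpr_eq1 _ _ N) ?cmod_ge0 //.
by rewrite -cmodX zN cmod1.
Qed.

(** [X^N - 1] splits over [R[i]] and is separable, so it has [N] distinct roots. *)
Lemma prim_root_exists N : (0 < N)%N -> exists w : R[i], N.-primitive_root w.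
Proof.
move=> N0; have [r Dp] := closed_field_poly_normal ('X^N - 1 : {poly R[i]}).
rewrite (monicP _) ?monicXnsubC // scale1r in Dp.
have rn1: all N.-unity_root r by apply/allP=> z; rewrite -root_prod_XsubC -Dp.
have sz_r: (N < (size r).+1)%N.
  by rewrite -(size_prod_XsubC r id) -Dp size_XnsubC.
have [|z] := hasP (has_prim_root N0 rn1 _ sz_r); last by exists z.
by rewrite -separable_prod_XsubC -Dp separable_Xn_sub_1 // pnatr_eq0 -lt0n.
Qed.

Lemma sum_prim_root N (w : R[i]) (k k' : 'I_N) : N.-primitive_root w ->
  \sum_(l < N) (w ^+ k / w ^+ k') ^+ l = (k == k')%:R * N%:R.
Proof.
move=> wN; have N0 := prim_order_gt0 wN.
have w0 : w != 0 by rewrite (prim_root_eq0 wN) -lt0n.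
have [->|kk'] := eqVneq k k'.
  rewrite divff ?expf_neq0 // mul1r.
  by under eq_bigr do rewrite expr1n; rewrite sumr_const card_ord.
set q := w ^+ k / w ^+ k'.
have q1 : q != 1.
  apply: contra kk' => /eqP /divr1_eq /eqP.
  by rewrite (eq_prim_root_expr wN) !modn_small.
rewrite mul0r; have := subrX1 q N.
rewrite /q exprMn exprVn -!exprM ![(_ * N)%N]mulnC !exprM (prim_expr_order wN).
rewrite !expr1n invr1 mulr1 subrr => /esym/eqP.
by rewrite mulf_eq0 subr_eq0 -/q (negPf q1) => /eqP.
Qed.

(** Integrals over the circle are replaced by averages over roots of unity; [size p <= N] excludes
    aliasing, so the identity is exact. *)
Lemma parseval N (w : R[i]) (p : {poly R[i]}) : N.-primitive_root w -> (size p <= N)%N ->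
  \sum_(l < N) cmod p.[w ^+ l] ^+ 2 = N%:R * \sum_(k < N) cmod p`_k ^+ 2.
Proof.
move=> wN szp; apply: complexI.
have w1 := cmod_unity_root (prim_order_gt0 wN) (prim_expr_order wN).
rewrite rmorph_sum rmorphM rmorph_nat /= rmorph_sum /=.
transitivity (\sum_(l < N) \sum_(k < N) \sum_(k' < N)
   (p`_k * ((p`_k')^*)%C) * (w ^+ k / w ^+ k') ^+ l).
  apply: eq_bigr => l _; rewrite cmod_sqrC (horner_coef_wide _ szp).
  rewrite rmorph_sum mulr_suml; apply: eq_bigr => k _.
  rewrite mulr_sumr; apply: eq_bigr => k' _.
  rewrite rmorphM !rmorphXn /= (conj_unimodular w1).
  have -> : (w ^+ k / w ^+ k') ^+ l = (w ^+ l) ^+ k * (w^-1 ^+ l) ^+ k'.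
    by rewrite exprMn -exprVn -!exprM ![(l * _)%N]mulnC.
  by rewrite mulrACA.
rewrite exchange_big mulr_sumr; apply: eq_bigr => k _ /=.
rewrite exchange_big (bigD1 k) //= -mulr_sumr sum_prim_root // eqxx mul1r.
rewrite big1 => [|k' kk']; first by rewrite addr0 cmod_sqrC mulrC.
by rewrite -mulr_sumr sum_prim_root // eq_sym (negPf kk') mul0r mulr0.
Qed.

Lemma parseval_le (p : {poly R[i]}) (M : R) N :
  (forall z, cmod z = 1 -> cmod p.[z] <= M) ->
  \sum_(k < N) cmod p`_k ^+ 2 <= M ^+ 2.
Proof.
(* The order is at least 1 for existence, at least [size p] for Parseval, and at least [N] to
   contain the truncated sum. *)
move=> pM; have [w wQ] := @prim_root_exists (maxn 1 (maxn N (size p))) (leq_maxl _ _).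
set Q := maxn _ _ in wQ.
have Q0 : (0 : R) < Q%:R by rewrite ltr0n (prim_order_gt0 wQ).
have NQ : (N <= Q)%N by rewrite /Q !leq_max leqnn orbT.
have w1 := cmod_unity_root (prim_order_gt0 wQ) (prim_expr_order wQ).
rewrite -(ler_pM2l Q0); apply: (@le_trans _ _ (\sum_(l < Q) cmod p.[w ^+ l] ^+ 2)).
  rewrite (parseval wQ) /Q ?leq_max ?leqnn ?orbT // ler_pM2l //.
  rewrite -/Q (big_ord_widen Q (fun k => cmod p`_k ^+ 2) NQ).
  by rewrite [leRHS](bigID (fun k : 'I_Q => (k < N)%N)) /= lerDl sumr_ge0 // => k _; rewrite
      sqr_ge0.
apply: (@le_trans _ _ (\sum_(l < Q) M ^+ 2)); last first.
  by rewrite sumr_const card_ord mulr_natl.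
apply: ler_sum => l _; rewrite ler_sqr ?nnegrE ?cmod_ge0 //.
  by apply: pM; rewrite cmodX w1 expr1n.
by apply: le_trans (pM 1 cmod1); exact: cmod_ge0.
Qed.
End Modulus.

(** * Cauchy-Schwarz for finite real sums *)

Section CauchySchwarz.
Context {R : realType} {I : Type}.
Implicit Types (r : seq I) (P : pred I) (a b : I -> R).

Lemma cauchy_schwarz r P a b :
  (\sum_(i <- r | P i) a i * b i) ^+ 2
  <= (\sum_(i <- r | P i) a i ^+ 2) * (\sum_(i <- r | P i) b i ^+ 2).
Proof.
pose A s := \sum_(i <- s | P i) a i ^+ 2; pose B s := \sum_(i <- s | P i) b i ^+ 2.
have A0 s : 0 <= A s by apply: sumr_ge0 => i _; rewrite sqr_ge0.
have B0 s : 0 <= B s by apply: sumr_ge0 => i _; rewrite sqr_ge0.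
elim: r => [|i r IH]; first by rewrite !big_nil expr0n mulr0.
rewrite !big_cons; case: ifP => // _.
move: (A0 r) (B0 r) IH; rewrite /A /B.
move: (\sum_(i <- r | P i) a i * b i) (\sum_(i <- r | P i) a i ^+ 2) (\sum_(i <- r | P i) b
    i ^+ 2).
move=> S U V U0 V0 SUV; move: (a i) (b i) => x y.
(* The cross term: [S ^ 2 <= U V] by induction, then the arithmetic-geometric mean inequality for
   [U y ^ 2] and [V x ^ 2]. *)
suff h : 2 * (S * (x * y)) <= U * y ^+ 2 + V * x ^+ 2.
  rewrite sqrrD mulrDl !mulrDr; lra.
have W0 : 0 <= U * y ^+ 2 + V * x ^+ 2 by rewrite addr_ge0 // mulr_ge0 // sqr_ge0.
apply: le_trans (ler_norm _) _; rewrite -ler_sqr ?nnegrE ?normr_ge0 //.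
rewrite real_normK ?num_real //.
apply: (@le_trans _ _ (4 * (U * V) * (x * y) ^+ 2)).
  have := ler_wpM2r (sqr_ge0 (x * y)) SUV; nra.
rewrite -subr_ge0.
have -> : (U * y ^+ 2 + V * x ^+ 2) ^+ 2 - 4 * (U * V) * (x * y) ^+ 2
  = (U * y ^+ 2 - V * x ^+ 2) ^+ 2 by ring.
exact: sqr_ge0.
Qed.

Lemma sum_mul_le_sqrt r P a b :
  \sum_(i <- r | P i) a i * b i
  <= Num.sqrt (\sum_(i <- r | P i) a i ^+ 2) * Num.sqrt (\sum_(i <- r | P i) b i ^+ 2).
Proof.
have A0 : 0 <= \sum_(i <- r | P i) a i ^+ 2 by apply: sumr_ge0 => i _; rewrite sqr_ge0.
rewrite -sqrtrM // (le_trans (ler_norm _)) // -sqrtr_sqr.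
by rewrite ler_sqrt ?cauchy_schwarz // mulr_ge0 // sumr_ge0 // => i _; rewrite sqr_ge0.
Qed.
End CauchySchwarz.

(** * One variable *)

Section OneVariable.
Context {R : realType}.
Implicit Types (f g p q : {poly R[i]}) (N : nat).

(** The squared Hardy norm of f(z / sqrt 2), truncated at degree [N]. The weights lie below the
    Bergman weights 1/(k+1). *)
Definition bergman N f : R := \sum_(k < N) 2 ^- k * cmod f`_k ^+ 2.

Lemma bergman_ge0 N f : 0 <= bergman N f.
Proof. by apply: sumr_ge0 => k _; rewrite mulr_ge0 ?sqr_ge0 // invr_ge0 exprn_ge0. Qed.

(** Serves twice: on consecutive coefficients of a polynomial, and with |a| = b = 1 to compare |z -
    al| and |1 - al^* z| on the circle. *)
Lemma cmod_mobius (al a b : R[i]) :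
  cmod (a - al * b) ^+ 2 - cmod (b - (al^*)%C * a) ^+ 2
  = (1 - cmod al ^+ 2) * (cmod a ^+ 2 - cmod b ^+ 2).
Proof.
rewrite !cmod_sqr; case: al => x y; case: a => a a'; case: b => b b' /=; ring.
Qed.

(** The shift moves every coefficient to a smaller weight. *)
Lemma bergman_shift N q : bergman N ('X * q) <= bergman N q.
Proof.
case: N => [|N]; rewrite /bergman; first by rewrite !big_ord0.
rewrite big_ord_recl /= coefXM /= cmod0 expr0n mulr0 add0r.
rewrite [leRHS]big_ord_recr /= ler_wpDr //.
  by rewrite mulr_ge0 ?sqr_ge0 // invr_ge0 exprn_ge0.
apply: ler_sum => k _; rewrite coefXM /= ler_wpM2r ?sqr_ge0 //.
by rewrite lef_pV2 ?posrE ?exprn_gt0 // ler_eXn2l ?ltr1n // leqnSn.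
Qed.

(* |z - al| = |1 - al^* z| on the circle, so this trades a zero inside the
   disc for one outside without changing the L1 norm. *)
Lemma bergman_flip_zero N (al : R[i]) q : cmod al <= 1 ->
  bergman N (('X - al%:P) * q) <= bergman N ((1 - ((al^*)%C)%:P * 'X) * q).
Proof.
move=> al1; rewrite -subr_ge0 /bergman -sumrB.
(* [cmod_mobius] applied to each pair of coefficients of ['X * q] and [q] factors the difference;
   both factors are nonnegative. *)
suff -> : \sum_(k < N) (2 ^- k * cmod ((1 - ((al^*)%C)%:P * 'X) * q)`_k ^+ 2
     - 2 ^- k * cmod (('X - al%:P) * q)`_k ^+ 2)
   = (1 - cmod al ^+ 2) * (bergman N q - bergman N ('X * q)).
  rewrite mulr_ge0 ?subr_ge0 ?bergman_shift //.
  by rewrite expr_le1 ?cmod_ge0.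
rewrite /bergman -sumrB mulr_sumr; apply: eq_bigr => k _.
rewrite -!mulrBr mulrCA; congr (_ * _).
have -> : ((1 - ((al^*)%C)%:P * 'X) * q)`_k = q`_k - (al^*)%C * ('X * q)`_k.
  by rewrite mulrBl mul1r coefB -mulrA coefCM.
have -> : (('X - al%:P) * q)`_k = ('X * q)`_k - al * q`_k.
  by rewrite mulrBl coefB coefCM.
have := cmod_mobius al ('X * q)`_k q`_k.
set A := cmod _ ^+ 2; set B := cmod _ ^+ 2; move=> AB.
by rewrite -(opprB A B) AB -mulrN opprB.
Qed.

Lemma bergman_triangle N f g :
  Num.sqrt (bergman N (f + g)) <= Num.sqrt (bergman N f) + Num.sqrt (bergman N g).
Proof.
have cs : \sum_(k < N) 2 ^- k * (cmod f`_k * cmod g`_k)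
    <= Num.sqrt (bergman N f) * Num.sqrt (bergman N g).
  pose v k : R := Num.sqrt (2 ^- k).
  have vE k : v k ^+ 2 = 2 ^- k by rewrite sqr_sqrtr // invr_ge0 exprn_ge0.
  have := sum_mul_le_sqrt (index_enum 'I_N) xpredT
    (fun k => v k * cmod f`_k) (fun k => v k * cmod g`_k).
  rewrite /bergman; under eq_bigr do rewrite mulrACA -expr2 vE.
  under [X in Num.sqrt X * _]eq_bigr do rewrite exprMn vE.
  by under [X in _ * Num.sqrt X]eq_bigr do rewrite exprMn vE.
rewrite -ler_sqr ?nnegrE ?addr_ge0 ?sqrtr_ge0 // sqrrD !sqr_sqrtr ?bergman_ge0 //.
apply: (@le_trans _ _ (bergman N f + (\sum_(k < N) 2 ^- k * (cmod f`_k * cmod g`_k)) *+ 2 +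
    bergman N g)).
  rewrite /bergman -sumrMnl -!big_split /=; apply: ler_sum => k _.
  rewrite coefD -mulrnAr -!mulrDr ler_wpM2l ?invr_ge0 ?exprn_ge0 //.
  by rewrite -sqrrD ler_sqr ?nnegrE ?addr_ge0 ?cmod_ge0 // ler_cmodD.
by rewrite lerD2r lerD2l ler_wMn2r.
Qed.

(* Carleman's argument, with its weights [1/(k+1)] lowered to [2^-k]. *)
Lemma carleman N M g : (size g <= M)%N ->
  Num.sqrt (bergman N (g ^+ 2)) <= \sum_(k < M) cmod g`_k ^+ 2.
Proof.
move=> szg; have S0 : 0 <= \sum_(k < M) cmod g`_k ^+ 2.
  by apply: sumr_ge0 => k _; rewrite sqr_ge0.
rewrite -(ger0_norm S0) -sqrtr_sqr ler_sqrt ?sqr_ge0 //.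
(* The square of the right-hand side is B(1)^2, the sum of the coefficients of [B ^+ 2], to be
   compared with the left-hand side degree by degree. *)
pose B : {poly R} := \poly_(k < M) (cmod g`_k ^+ 2).
have BE k : B`_k = cmod g`_k ^+ 2.
  rewrite coef_poly; case: ltnP => // Mk.
  by rewrite nth_default ?cmod0 ?expr0n // (leq_trans szg).
have B1 : B.[1] = \sum_(k < M) cmod g`_k ^+ 2.
  by rewrite horner_poly; apply: eq_bigr => k _; rewrite expr1n mulr1.
rewrite -B1 -horner_exp (horner_coef_wide _ (leq_maxl (size (B ^+ 2)) N)).
set Q := maxn _ _; have NQ : (N <= Q)%N by rewrite leq_maxr.
have BB k : (B ^+ 2)`_k = \sum_(i < k.+1) cmod g`_i ^+ 2 * cmod g`_(k - i) ^+ 2.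
  by rewrite expr2 coefM; apply: eq_bigr => i _; rewrite !BE.
have BB0 k : 0 <= (B ^+ 2)`_k.
  by rewrite BB sumr_ge0 // => i _; rewrite mulr_ge0 ?sqr_ge0.
apply: (@le_trans _ _ (\sum_(k < N) (B ^+ 2)`_k)); last first.
  rewrite (big_ord_widen Q (fun k => (B ^+ 2)`_k) NQ).
  rewrite [leRHS](bigID (fun k : 'I_Q => (k < N)%N)) /=.
  under [X in _ <= X + _]eq_bigr do rewrite expr1n mulr1.
  by rewrite lerDl sumr_ge0 // => k _; rewrite expr1n mulr1.
apply: ler_sum => k _; rewrite BB.
rewrite -[leRHS](mulKf (x := 2 ^+ k)) ?expf_neq0 ?pnatr_eq0 //.
rewrite ler_pM2l ?invr_gt0 ?exprn_gt0 //.
(* Cauchy-Schwarz on the [k.+1] terms of the convolution costs [k.+1], which is at most [2 ^ k]. *)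
apply: (@le_trans _ _ (k.+1%:R * \sum_(i < k.+1) cmod g`_i ^+ 2 * cmod g`_(k - i) ^+ 2));
    last first.
  rewrite ler_wpM2r -?BB //.
  by rewrite -natrX ler_nat ltn_expl.
rewrite expr2 coefM.
apply: (@le_trans _ _ ((\sum_(i < k.+1) cmod g`_i * cmod g`_(k - i)) ^+ 2)).
  rewrite ler_sqr ?nnegrE ?cmod_ge0 //.
    by rewrite (le_trans (ler_cmod_sum _ _ _)) // ler_sum // => i _; rewrite cmodM.
  by apply: sumr_ge0 => i _; rewrite mulr_ge0 ?cmod_ge0.
have := cauchy_schwarz (index_enum 'I_k.+1) xpredT
  (fun i => cmod g`_i * cmod g`_(k - i)) (fun=> 1).
rewrite expr1n sumr_const card_ord mulrC.
under eq_bigr do rewrite mulr1.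
by under [X in _ * X]eq_bigr do rewrite exprMn.
Qed.

(* [1 - sqrt_iter be n] approximates a square root of [1 - be X]; [sqrt_iter1] is
   the extremal case [be = X = 1], which majorises the others. *)
Fixpoint sqrt_iter (be : R[i]) n : {poly R[i]} :=
  if n is n'.+1 then 2^-1%:P * (be%:P * 'X + sqrt_iter be n' ^+ 2) else 0.

Fixpoint sqrt_iter1 n : R := if n is n'.+1 then (1 + sqrt_iter1 n' ^+ 2) / 2 else 0.

Lemma sqrt_iter1_bounds n :
  [/\ 0 <= sqrt_iter1 n, sqrt_iter1 n <= 1 & sqrt_iter1 n <= sqrt_iter1 n.+1].
Proof.
elim: n => [|n [t0 t1 tS]] /=; first by split => //; rewrite expr0n; lra.
move: t0 t1 tS; rewrite /=; set t := sqrt_iter1 n => t0 t1 tS.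
split; nra.
Qed.

(* The increments are nonincreasing and telescope to at most 1. *)
Lemma sqrt_iter1_incr n : n.+1%:R * (sqrt_iter1 n.+1 - sqrt_iter1 n) <= sqrt_iter1 n.+1.
Proof.
elim: n => [|n IH]; first by rewrite mul1r /= subr0.
have [t0 t1 tS] := sqrt_iter1_bounds n.
have [u0 u1 uS] := sqrt_iter1_bounds n.+1.
rewrite [n.+2%:R]mulrS mulrDl mul1r -lerBrDl opprB addrCA subrr addr0.
apply: le_trans IH; rewrite ler_pM2l ?ltr0n //.
have -> : sqrt_iter1 n.+2 = (1 + sqrt_iter1 n.+1 ^+ 2) / 2 by [].
have E : sqrt_iter1 n.+1 = (1 + sqrt_iter1 n ^+ 2) / 2 by [].
move: E t0 t1 tS u0 u1; set t := sqrt_iter1 n; set u := sqrt_iter1 n.+1 => E t0 t1 tS u0 u1.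
nra.
Qed.

Lemma horner_sqrt_iter (be z : R[i]) n :
  (sqrt_iter be n.+1).[z] = 2^-1 * (be * z + (sqrt_iter be n).[z] ^+ 2).
Proof. by rewrite /= hornerM hornerD hornerM horner_exp !hornerC hornerX. Qed.

Lemma horner_1subCX (be z : R[i]) : (1 - be%:P * 'X).[z] = 1 - be * z.
Proof. by rewrite hornerD hornerN hornerM hornerX -polyC1 !hornerC. Qed.

(** The difference of successive iterates is half the previous difference times the sum of the two
    previous iterates, so both bounds propagate together. *)
Lemma sqrt_iter_bounds (be z : R[i]) n : cmod be <= 1 -> cmod z <= 1 ->
  cmod (sqrt_iter be n).[z] <= sqrt_iter1 n /\
  cmod ((sqrt_iter be n.+1).[z] - (sqrt_iter be n).[z]) <= sqrt_iter1 n.+1 - sqrt_iter1 n.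
Proof.
move=> be1 z1.
have c2 : cmod (2^-1 : R[i]) = 2^-1.
  by rewrite cmodV -[2]/((2%:R)) -(rmorph_nat (@real_complex R)) cmod_real ger0_norm.
have bz : cmod (be * z) <= 1 by rewrite cmodM mulr_ile1 ?cmod_ge0.
have S k := horner_sqrt_iter be z k.
elim: n => [|n [IH1 IH2]].
  rewrite S /= !hornerE cmod0 expr0n addr0 subr0 cmodM c2 expr0n addr0 subr0; split => //.
  by rewrite mul1r ler_piMr ?invr_ge0.
have [t0 t1 tS] := sqrt_iter1_bounds n.
have step : cmod (sqrt_iter be n.+1).[z] <= sqrt_iter1 n.+1.
  rewrite S cmodM c2 /= mulrC ler_pM2r ?invr_gt0 //.
  apply: le_trans (ler_cmodD _ _) _; apply: lerD => //.
  by rewrite cmodX lerXn2r ?nnegrE ?cmod_ge0.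
split => //.
have -> : (sqrt_iter be n.+2).[z] - (sqrt_iter be n.+1).[z] =
   2^-1 * (((sqrt_iter be n.+1).[z] - (sqrt_iter be n).[z]) *
           ((sqrt_iter be n.+1).[z] + (sqrt_iter be n).[z])).
  by rewrite S [in X in _ - X]S; ring.
have -> : sqrt_iter1 n.+2 - sqrt_iter1 n.+1 = 2^-1 * ((sqrt_iter1 n.+1 - sqrt_iter1 n) *
    (sqrt_iter1 n.+1 + sqrt_iter1 n)).
  have E k : sqrt_iter1 k.+1 = (1 + sqrt_iter1 k ^+ 2) / 2 by [].
  by rewrite E [in X in _ - X]E; field.
rewrite cmodM c2 ler_pM2l ?invr_gt0 // cmodM ler_pM ?cmod_ge0 //.
by rewrite (le_trans (ler_cmodD _ _)) // lerD.
Qed.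

(** A polynomial without zeros in the open disc has a holomorphic square root there, in general not
    a polynomial; this is the substitute to which [carleman] can be applied. *)
Definition square_approximable f := forall eta : R, 0 < eta ->
  exists g, forall z, cmod z = 1 -> cmod (g.[z] ^+ 2 - f.[z]) <= eta.

(** With [y] an iterate, the error of the approximate square root [1 - y] is twice the next
    increment of the iteration. *)
Lemma sqrt_residual (F : numFieldType) (x y : F) :
  (1 - y) ^+ 2 - (1 - x) = 2 * (2^-1 * (x + y ^+ 2) - y).
Proof. by field. Qed.

Lemma square_approximable_linear (be : R[i]) : cmod be <= 1 ->
  square_approximable (1 - be%:P * 'X).
Proof.
move=> be1 eta eta0.
(* The error is twice an increment, hence at most 2/(n+1) by [sqrt_iter1_incr]. *)
pose n := (Num.trunc (2 / eta)).+1.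
have n_big : 2 / eta < n%:R by rewrite /n truncnS_gt. 
exists (1 - sqrt_iter be n) => z z1.
have z1' : cmod z <= 1 by rewrite z1.
have [_ h] := sqrt_iter_bounds n be1 z1'.
have -> : (1 - sqrt_iter be n).[z] ^+ 2 - (1 - be%:P * 'X).[z] =
    2 * ((sqrt_iter be n.+1).[z] - (sqrt_iter be n).[z]).
  rewrite horner_sqrt_iter horner_1subCX hornerD hornerN -polyC1 hornerC.
  exact: sqrt_residual.
have c2 : cmod (2 : R[i]) = 2.
  by rewrite -[2]/(2%:R) -(rmorph_nat (@real_complex R)) cmod_real ger0_norm.
rewrite cmodM c2.
have [_ u1 _] := sqrt_iter1_bounds n.+1.
have := sqrt_iter1_incr n.
move: n_big h u1; rewrite ltr_pdivrMr // -/(sqrt_iter1 n.+1).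
set t := _ - sqrt_iter1 n; set u := sqrt_iter1 n.+1; set c := cmod _.
have n1 : (0 : R) < n.+1%:R by rewrite ltr0n.
have nn : (n%:R : R) <= n.+1%:R by rewrite ler_nat.
move=> h1 h2 h3 h4.
have h5 : n.+1%:R * (2 * c) <= n.+1%:R * eta.
  apply: (@le_trans _ _ 2); last by rewrite (le_trans (ltW h1)) // ler_wpM2r // ltW.
  rewrite mulrCA ler_piMr // (le_trans _ h3) // (le_trans _ h4) //.
  by rewrite ler_pM2l.
by rewrite ler_pM2l in h5.
Qed.

Lemma horner_circle_bound f : exists2 M : R, 0 < M & forall z, cmod z = 1 -> cmod f.[z] <= M.
Proof.
exists (1 + \sum_(k < size f) cmod f`_k) => [|z z1].
  by rewrite ltr_wpDr // sumr_ge0 // => k _; rewrite cmod_ge0.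
rewrite horner_coef (le_trans (ler_cmod_sum _ _ _)) // ler_wpDl //.
by apply: ler_sum => k _; rewrite cmodM cmodX z1 expr1n mulr1.
Qed.

Lemma square_approximableM f g :
  square_approximable f -> square_approximable g -> square_approximable (f * g).
Proof.
move=> af ag eta eta0.
have [Mf Mf0 hf] := horner_circle_bound f; have [Mg Mg0 hg] := horner_circle_bound g.
(* Here [Mf + 1] will bound |a^2| on the circle, thanks to the [1] in the minimum chosen for [a]. *)
have [b hb] := ag (eta / (2 * (Mf + 1))) ltac:(by rewrite divr_gt0 ?mulr_gt0 ?addr_gt0).
have [a ha] := af (Num.min 1 (eta / (2 * Mg))) ltac:(by rewrite lt_min ltr01 divr_gt0
    ?mulr_gt0).
exists (a * b) => z z1; move: (hb z z1) (ha z z1) (hf z z1) (hg z z1).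
rewrite le_min !hornerM => {}hb /andP[ha1 ha2] {}hf {}hg.
have a2 : cmod (a.[z] ^+ 2) <= Mf + 1.
  rewrite -[a.[z] ^+ 2](subrK f.[z]) (le_trans (ler_cmodD _ _)) // addrC lerD //.
have -> : (a.[z] * b.[z]) ^+ 2 - f.[z] * g.[z] =
  a.[z] ^+ 2 * (b.[z] ^+ 2 - g.[z]) + g.[z] * (a.[z] ^+ 2 - f.[z]) by ring.
apply: le_trans (ler_cmodD _ _) _; rewrite (cmodM (_ ^+ 2)) (cmodM g.[z]).
apply: (@le_trans _ _ ((Mf + 1) * (eta / (2 * (Mf + 1))) + Mg * (eta / (2 * Mg)))).
  by apply: lerD; apply: ler_pM; rewrite ?cmod_ge0.
have M1 : Mf + 1 != 0 by rewrite gt_eqF ?addr_gt0.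
have M2 : Mg != 0 by rewrite gt_eqF.
suff -> : (Mf + 1) * (eta / (2 * (Mf + 1))) + Mg * (eta / (2 * Mg)) = eta by [].
by field; rewrite M1 M2.
Qed.

Lemma square_approximableC (c : R[i]) : square_approximable c%:P.
Proof.
move=> eta eta0; exists (sqrtc c)%:P => z _.
by rewrite !hornerE sqr_sqrtc subrr cmod0 ltW.
Qed.

(** Zeros in the closed disc are flipped one at a time, the others kept as [- a * (1 - a^-1 X)]. The
    cofactor [q] lets the induction treat one linear factor while the rest stand by. *)
Lemma outer_part_prod (rs : seq R[i]) : exists F0 : {poly R[i]},
  [/\ square_approximable F0,
      forall z, cmod z = 1 -> cmod F0.[z] = cmod (\prod_(a <- rs) ('X - a%:P)).[z] &
      forall N q, bergman N ((\prod_(a <- rs) ('X - a%:P)) * q) <= bergman N (F0 * q)].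
Proof.
elim: rs => [|a rs [F0 [apF F0z F0N]]].
  by exists 1; rewrite big_nil; split => //; rewrite -polyC1; exact: square_approximableC.
rewrite big_cons; case: (leP (cmod a) 1) => a1.
  exists ((1 - ((a^*)%C)%:P * 'X) * F0); split.
  - by apply: square_approximableM => //; apply: square_approximable_linear; rewrite cmod_conj.
  - move=> z z1; rewrite !hornerM !cmodM F0z //; congr (_ * _).
    have := cmod_mobius a z 1; rewrite z1 cmod1 subrr mulr0 mulr1.
    rewrite horner_1subCX hornerD hornerX hornerN hornerC => /eqP; rewrite subr_eq0 eq_sym.
    by rewrite eqrXn2 ?cmod_ge0 // => /eqP.
  - move=> N q; rewrite -mulrA (le_trans (bergman_flip_zero _ _ a1)) //.
    by rewrite mulrCA (le_trans (F0N _ _)) // mulrCA mulrA.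
have a0 : a != 0 by rewrite -cmod_eq0 gt_eqF // (lt_trans ltr01).
exists (('X - a%:P) * F0); split.
- apply: square_approximableM => //.
  have -> : 'X - a%:P = (- a)%:P * (1 - (a^-1)%:P * 'X).
    rewrite mulrBr mulr1 mulrA -polyCM mulNr divff // !polyCN polyC1.
    by rewrite mulN1r opprK addrC.
  apply: square_approximableM; first exact: square_approximableC.
  by apply: square_approximable_linear; rewrite cmodV invf_le1 ?ltW // (lt_trans ltr01).
- by move=> z z1; rewrite !hornerM !cmodM F0z.
- by move=> N q; rewrite -mulrA mulrCA (le_trans (F0N _ _)) // mulrCA mulrA.
Qed.

Lemma outer_part f : exists F : {poly R[i]},
  [/\ square_approximable F,
      forall z, cmod z = 1 -> cmod F.[z] = cmod f.[z] &
      forall N, bergman N f <= bergman N F].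
Proof.
have [rs ->] := closed_field_poly_normal f.
have [F0 [apF F0z F0N]] := outer_part_prod rs.
exists ((lead_coef f)%:P * F0); rewrite -mul_polyC; split.
- by apply: square_approximableM => //; exact: square_approximableC.
- by move=> z z1; rewrite !hornerM !cmodM F0z.
- by move=> N; rewrite mulrC (le_trans (F0N _ _)) // mulrC.
Qed.

(** Each [f s] is replaced by its outer part and then by a square [g s ^+ 2]; [carleman] and
    Parseval turn its norm into an average of |g s|^2 over roots of unity. Using the same roots for
    all [s] allows the pointwise bound on the sum. *)
Lemma bergman_le_hardy (S : finType) (f : S -> {poly R[i]}) (K : R) N :
  (forall z, cmod z = 1 -> \sum_s cmod (f s).[z] <= K) ->
  \sum_s Num.sqrt (bergman N (f s)) <= K.
Proof.
move=> fK; apply/ler_addgt0Pr => e e0.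
(* Each member of the family loses [eta] twice, in norm and in the average; the [+ 1] covers empty
   [S]. *)
pose eta : R := e / (2 * #|S|%:R + 1).
have eta0 : 0 < eta by rewrite divr_gt0 // ltr_wpDl // mulr_ge0.
have [F FP] := choice (fun s => outer_part (f s)).
have /choice[g gP] : forall s, exists g : {poly R[i]},
    forall z, cmod z = 1 -> cmod (g.[z] ^+ 2 - (F s).[z]) <= eta.
  by move=> s; have [/(_ _ eta0)] := FP s.
pose M := (1 + \sum_s size (g s))%N.
have gM s : (size (g s) <= M)%N by rewrite /M (bigD1 s) //= addnCA leq_addr.
have [w wM] := @prim_root_exists R M isT.
have M0 : (0 : R) < M%:R by rewrite ltr0n.
have w1 := cmod_unity_root (prim_order_gt0 wM) (prim_expr_order wM).
have step s : Num.sqrt (bergman N (f s)) <= \sum_(k < M) cmod (g s)`_k ^+ 2 + eta.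
  have [_ _ FN] := FP s.
  apply: (@le_trans _ _ (Num.sqrt (bergman N (F s)))); first by rewrite ler_sqrt ?bergman_ge0.
  rewrite -[F s](subrK (g s ^+ 2)) addrC (le_trans (bergman_triangle _ _ _)) //.
  apply: lerD; first exact: carleman.
  rewrite -(ger0_norm (ltW eta0)) -sqrtr_sqr ler_sqrt ?sqr_ge0 //.
  apply: (@le_trans _ _ (\sum_(k < N) cmod (F s - g s ^+ 2)`_k ^+ 2)).
    apply: ler_sum => k _; rewrite ler_piMl ?sqr_ge0 // invf_le1 ?exprn_gt0 //.
    by rewrite exprn_ege1 // ler1n.
  apply: parseval_le => z z1; rewrite hornerD hornerN horner_exp -cmodN opprB.
  exact: gP.
have avg : M%:R * \sum_s \sum_(k < M) cmod (g s)`_k ^+ 2 <= M%:R * (K + #|S|%:R * eta).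
  rewrite mulr_sumr; under eq_bigr do rewrite -(parseval wM) //.
  rewrite exchange_big /= mulr_natl -[X in _ *+ X]card_ord -sumr_const.
  apply: ler_sum => l _; have wl1 : cmod (w ^+ l) = 1 by rewrite cmodX w1 expr1n.
  apply: le_trans (lerD (fK _ wl1) (lexx _)).
  rewrite mulr_natl -[X in _ *+ X]/(#|S|) -sumr_const -big_split; apply: ler_sum => s _ /=.
  have [_ Fz _] := FP s; rewrite -Fz // -cmodX.
  by rewrite -[X in cmod X](subrK (F s).[w ^+ l]) (le_trans (ler_cmodD _ _)) // addrC lerD2r
      gP.
move: avg; rewrite ler_pM2l // => avg.
apply: le_trans (ler_sum _ (fun s _ => step s)) _.
rewrite big_split /= sumr_const -mulr_natl.
apply: le_trans (lerD avg (lexx _)) _.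
rewrite -addrA lerD2l.
have -> : #|S|%:R * eta + #|S|%:R * eta = (2 * #|S|%:R) * eta by ring.
rewrite /eta mulrCA ler_piMr ?(ltW e0) // ler_pdivrMr ?mul1r ?lerDl //.
Qed.
End OneVariable.

(** * Several variables *)

Section SeveralVariables.
Context {R : realType}.

(* A finite family of polynomials is handled at once, so that the l2 norm over
   the powers of the last variable can be linearised by weights [lam] and
   absorbed into the family; this plays the role of Minkowski's inequality. *)
Lemma hypercontractive_family n (S X : finType) (a : S -> X -> R[i])
    (e : X -> nat -> nat) (K : R) :
  (forall s x y, a s x != 0 -> a s y != 0 ->
     (forall i, (i < n)%N -> e x i = e y i) -> x = y) ->
  (forall z : nat -> R[i], (forall i, cmod (z i) = 1) ->
     \sum_s cmod (\sum_x a s x * \prod_(i < n) z i ^+ e x i) <= K) ->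
  \sum_s Num.sqrt (\sum_x 2 ^- (\sum_(i < n) e x i) * cmod (a s x) ^+ 2) <= K.
Proof.
elim: n S a K => [|n IH] S a K inj aK.
  apply: le_trans (aK (fun=> 1) (fun=> cmod1)).
  apply: ler_sum => s _; rewrite -[leRHS]ger0_norm ?cmod_ge0 // -sqrtr_sqr.
  rewrite ler_sqrt ?sqr_ge0 //.
  under eq_bigr do rewrite big_ord0 expr0 invr1 mul1r.
  under [X in _ <= cmod X ^+ 2]eq_bigr do rewrite big_ord0 mulr1.
  (* Without variables all exponents agree, so injectivity leaves at most one nonzero
     coefficient. *)
  case: (pickP (fun x => a s x != 0)) => [x ax|a0]; last first.
    by rewrite big1 ?sqr_ge0 // => x _; rewrite (eqP (negbFE (a0 x))) cmod0 expr0n.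
  have a0 y : y != x -> a s y = 0.
    move=> yx; apply/eqP; apply: contraNT yx => ay.
    by apply/eqP; apply: inj ay ax _.
  rewrite (bigD1 x) // [in leRHS](bigD1 x) //=.
  rewrite big1 ?addr0 => [|y /a0 ->]; last by rewrite cmod0 expr0n.
  by rewrite big1 ?addr0 // => y /a0.
pose D := (\max_x e x n).+1.
have eD x : (e x n < D)%N by rewrite ltnS (leq_bigmax (F := fun x => e x n)).
have eD_neq x (k : 'I_D) : k != Ordinal (eD x) -> (e x n == k) = false.
  by rewrite -val_eqE /= eq_sym => /negPf.
pose wt x : R := 2 ^- (\sum_(i < n) e x i).
have wt0 x : 0 <= wt x by rewrite invr_ge0 exprn_ge0.
pose b s k x := (e x n == k)%:R * a s x.
pose B s k := Num.sqrt (\sum_x wt x * cmod (b s k x) ^+ 2).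
pose T s := Num.sqrt (\sum_x 2 ^- (\sum_(i < n.+1) e x i) * cmod (a s x) ^+ 2).
have TB s : T s ^+ 2 = \sum_(k < D) 2 ^- k * B s k ^+ 2.
  rewrite sqr_sqrtr; last first.
    by apply: sumr_ge0 => x _; rewrite mulr_ge0 ?sqr_ge0 // invr_ge0 exprn_ge0.
  under [RHS]eq_bigr => k _.
    rewrite sqr_sqrtr; last by apply: sumr_ge0 => x _; rewrite mulr_ge0 ?sqr_ge0.
    rewrite mulr_sumr; over.
  rewrite exchange_big; apply: eq_bigr => x _ /=.
  rewrite [RHS](bigD1 (Ordinal (eD x))) //= [X in _ = _ + X]big1 ?addr0 => [|k kx].
    rewrite /b eqxx mul1r big_ord_recr /= exprD invfM -/(wt x).
    by move: (2 ^- e x n) => y; ring.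
  by rewrite /b (eD_neq _ _ kx) mul0r cmod0 expr0n !mulr0.
(* The weights of equality in Cauchy-Schwarz: they recover [T s] from the [B s k]. If [T s = 0] the
   inverse is 0, and so are the weights. *)
pose lam s (k : 'I_D) : R := 2 ^- k * B s k / T s.
have lam0 s k : 0 <= lam s k.
  by rewrite !mulr_ge0 ?invr_ge0 ?exprn_ge0 ?sqrtr_ge0.
have lamB s : \sum_(k < D) lam s k * B s k = T s.
  transitivity (T s ^+ 2 / T s); last first.
    have [->|T0] := eqVneq (T s) 0; first by rewrite invr0 mulr0.
    by rewrite expr2 mulfK.
  by rewrite TB mulr_suml; apply: eq_bigr => k _; rewrite /lam; ring.
have lam_le s (v : 'I_D -> R) : \sum_k lam s k * v k <= Num.sqrt (\sum_(k < D) 2 ^- k * v k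
    ^+ 2).
  pose h (k : nat) : R := Num.sqrt (2 ^- k).
  have hh k : h k ^+ 2 = 2 ^- k by rewrite sqr_sqrtr // invr_ge0 exprn_ge0.
  have -> : \sum_k lam s k * v k = \sum_(k < D) (h k * B s k / T s) * (h k * v k).
    by apply: eq_bigr => k _; rewrite /lam -hh; ring.
  apply: le_trans (sum_mul_le_sqrt _ _ _ _) _.
  under [X in _ * Num.sqrt X]eq_bigr do rewrite exprMn hh.
  rewrite ler_piMl ?sqrtr_ge0 // -[leRHS]sqrtr1 ler_sqrt //.
  under eq_bigr do rewrite exprMn exprMn hh.
  rewrite -mulr_suml -TB exprVn.
  by have [->|T0] := eqVneq (T s) 0; [rewrite expr0n mul0r ler01|rewrite divff ?expf_neq0].
have := IH (S * 'I_D)%type (fun sk x => ((lam sk.1 sk.2)%:C)%C * b sk.1 sk.2 x) K.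
have -> : \sum_(sk : S * 'I_D) Num.sqrt (\sum_x 2 ^- (\sum_(i < n) e x i) *
            cmod (((lam sk.1 sk.2)%:C)%C * b sk.1 sk.2 x) ^+ 2) = \sum_s T s.
  transitivity (\sum_s \sum_(k < D) lam s k * B s k); last by apply: eq_bigr => s _.
  rewrite pair_bigA /=; apply: eq_bigr => -[s k] _ /=.
  under eq_bigr do rewrite cmodM cmod_real exprMn mulrCA real_normK ?num_real //.
  by rewrite -mulr_sumr sqrtrM ?sqr_ge0 // sqrtr_sqr ger0_norm.
apply=> [[s k] x y /=|z z1].
  rewrite /b !mulf_eq0 !negb_or => /and3P[_ xk ax] /and3P[_ yk ay] exy.
  have {}xk : e x n = k by move: xk; rewrite pnatr_eq0 eqb0 negbK => /eqP.
  have {}yk : e y n = k by move: yk; rewrite pnatr_eq0 eqb0 negbK => /eqP.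
  apply: inj ax ay _ => i; rewrite ltnS leq_eqVlt => /orP[/eqP ->|/exy //].
  by rewrite xk yk.
(* With the first [n] variables frozen, the [A s k] are the coefficients in the last variable, where
   the one-variable inequality applies. *)
pose A s (k : nat) := \sum_x b s k x * \prod_(i < n) z i ^+ e x i.
pose f s : {poly R[i]} := \poly_(k < D) A s k.
apply: (@le_trans _ _ (\sum_s Num.sqrt (bergman D (f s)))).
  have -> : \sum_(sk : S * 'I_D) cmod (\sum_x ((lam sk.1 sk.2)%:C)%C * b sk.1 sk.2 x *
      \prod_(i < n) z i ^+ e x i)
    = \sum_s \sum_(k < D) lam s k * cmod (A s k).
    rewrite pair_bigA /=; apply: eq_bigr => -[s k] _ /=.
    rewrite -[X in X * cmod (A s k)]ger0_norm // -cmod_real -cmodM /A mulr_sumr.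
    by congr cmod; apply: eq_bigr => x _; rewrite mulrA.
  apply: ler_sum => s _; rewrite (le_trans (lam_le s _)) // /bergman.
  by under [X in _ <= Num.sqrt X]eq_bigr do rewrite coef_poly ltn_ord.
apply: bergman_le_hardy => t t1.
apply: le_trans (aK (fun i => if i == n then t else z i) _); last by move=> i; case: eqP.
rewrite le_eqVlt; apply/orP; left; apply/eqP; apply: eq_bigr => s _; congr cmod.
rewrite horner_poly; under eq_bigr do rewrite mulr_suml.
rewrite exchange_big; apply: eq_bigr => x _ /=.
rewrite [LHS](bigD1 (Ordinal (eD x))) //= [X in _ + X = _]big1 ?addr0 => [|k kx]; last first.
  by rewrite /b (eD_neq _ _ kx) !mul0r.
rewrite /b eqxx mul1r big_ord_recr /= eqxx -mulrA; congr (_ * (_ * _)).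
by apply: eq_bigr => i _; rewrite ltn_eqF.
Qed.
End SeveralVariables.

(** * Homogeneous polynomials: partial derivatives and mixed norms *)

Section HomogeneousPolynomials.
Context {R : realType}.
Variables (m n : nat) (c : m.-tuple 'I_n -> R[i]).
Implicit Types (z : 'I_n -> R[i]) (j : m.-tuple 'I_n).

Lemma supnorm_ge z : (forall i, cmod (z i) <= 1) -> cmod (hpoly_eval c z) <= supnorm c.
Proof.
move=> z1; apply: ub_le_sup; last by exists z.
(* [sup] dominates its set only once the set is known to be bounded. *)
exists (\sum_(j | inJ j) cmod (c j)) => _ [y y1 <-].
apply: le_trans (ler_cmod_sum _ _ _) _; apply: ler_sum => j _.
rewrite cmodM ler_piMr ?cmod_ge0 // cmod_prod.
by apply: prodr_ile1 => k _; rewrite cmod_ge0 /=; exact: y1.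
Qed.

Lemma supnorm_ge0 : 0 <= supnorm c.
Proof.
apply: le_trans (supnorm_ge (z := fun=> 0) _); first exact: cmod_ge0.
by move=> i; rewrite cmod0 ler01.
Qed.

Lemma hpoly_eval_le z (rho : R) : 0 < rho -> (forall i, cmod (z i) <= rho) ->
  cmod (hpoly_eval c z) <= rho ^+ m * supnorm c.
Proof.
move=> rho0 zr; pose r : R[i] := (rho%:C)%C.
have r0 : r != 0 by rewrite -cmod_eq0 cmod_real normr_eq0 gt_eqF.
have -> : hpoly_eval c z = r ^+ m * hpoly_eval c (fun i => z i / r).
  rewrite /hpoly_eval mulr_sumr; apply: eq_bigr => j _.
  rewrite mulrCA; congr (_ * _); rewrite big_split /= prodr_const card_ord.
  by rewrite exprVn mulrCA divff ?mulr1 // expf_neq0.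
rewrite cmodM cmodX cmod_real gtr0_norm // ler_pM2l ?exprn_gt0 //.
apply: supnorm_ge => i; rewrite cmodM cmodV cmod_real gtr0_norm //.
by rewrite ler_pdivrMr // mul1r.
Qed.

Lemma coef01_prod_1addCX (I : Type) (s : seq I) (x : I -> R[i]) :
  (\prod_(i <- s) (1 + (x i)%:P * 'X))`_0 = 1 /\
  (\prod_(i <- s) (1 + (x i)%:P * 'X))`_1 = \sum_(i <- s) x i.
Proof.
elim: s => [|i s [IH0 IH1]]; first by rewrite !big_nil !coefC.
rewrite !big_cons !mulrDl !mul1r !coefD -!mulrA !coefCM !coefXM /= IH0 IH1.
by rewrite mulr0 addr0 mulr1 addrC.
Qed.

Lemma sum_count_mem (V : nmodType) (s : seq 'I_n) (u : 'I_n -> V) :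
  \sum_(x <- s) u x = \sum_i u i *+ count_mem i s.
Proof.
elim: s => [|x s IH]; first by rewrite big_nil big1 // => i _; rewrite mulr0n.
rewrite big_cons IH (bigD1 x) // [RHS](bigD1 x) //= eqxx mulrnDr mulr1n addrA.
by congr (_ + _); apply: eq_bigr => i ix; rewrite eq_sym (negPf ix).
Qed.

Lemma prod_count_mem (s : seq 'I_n) z :
  \prod_(x <- s) z x = \prod_i z i ^+ count_mem i s.
Proof.
elim: s => [|x s IH]; first by rewrite big_nil big1.
rewrite big_cons IH (bigD1 x) // [RHS](bigD1 x) //= eqxx exprS mulrA.
by congr (_ * _); apply: eq_bigr => i ix; rewrite eq_sym (negPf ix).
Qed.

(** Distinct indices in J give distinct monomials, the injectivity that [hypercontractive_family]
    asks for. *)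
Lemma inJ_count_inj j j' : inJ j -> inJ j' ->
  (forall i, count_mem i j = count_mem i j') -> j = j'.
Proof.
move=> sj sj' jj'; apply: val_inj; apply: (sorted_eq _ _ sj sj').
- by move=> x y t; exact: leq_trans.
- by move=> x y /anti_leq /val_inj.
by apply/allP => i _; apply/eqP.
Qed.

Lemma unimodular_phase (z : R[i]) : exists2 u : R[i], cmod u = 1 & u * z = ((cmod z)%:C)%C.
Proof.
have [->|z0] := eqVneq z 0; first by exists 1; rewrite ?cmod1 // mulr0 cmod0.
have cz : cmod z != 0 by rewrite cmod_eq0.
exists (((cmod z)%:C)%C / z); last by rewrite divfK.
by rewrite cmodM cmodV cmod_real ger0_norm ?cmod_ge0 // divff.
Qed.

(* [sum_i |z_i dP/dz_i|] is the linear coefficient of [t |-> P(z (1 + t u))] for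
   a suitable unimodular [u]; it is estimated on the circle [|t| = 1/m]. *)
Lemma sum_cmod_partials_le z : (0 < m)%N -> (forall i, cmod (z i) = 1) ->
  \sum_i cmod (\sum_(j : m.-tuple 'I_n | inJ j) c j * (count_mem i j)%:R * \prod_(k < m) z
      (tnth j k))
  <= m%:R * expR 1 * supnorm c.
Proof.
move=> m0 z1; pose r : R := m%:R^-1.
have r0 : 0 < r by rewrite invr_gt0 ltr0n.
pose f i := \sum_(j : m.-tuple 'I_n | inJ j) c j * (count_mem i j)%:R * \prod_(k < m) z
    (tnth j k).
have /choice[u uP] : forall i, exists u : R[i], cmod u = 1 /\ u * f i = ((cmod (f i))%:C)%C.
  by move=> i; have [u] := unimodular_phase (f i); exists u.
pose x i := (r%:C)%C * u i.
pose Phi : {poly R[i]} := \sum_(j | inJ j) (c j * \prod_(k < m) z (tnth j k))%:P *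
   \prod_(i <- j) (1 + (x i)%:P * 'X).
have Phi1 : Phi`_1 = ((r * \sum_i cmod (f i))%:C)%C.
  have cj j : ((c j * \prod_(k < m) z (tnth j k))%:P * \prod_(i <- j) (1 + (x i)%:P * 'X))`_1
      = (r%:C)%C * \sum_i u i * (c j * (count_mem i j)%:R * \prod_(k < m) z (tnth j k)).
    rewrite coefCM (coef01_prod_1addCX _ _).2 -mulr_sumr mulrCA sum_count_mem.
    congr (_ * _); rewrite mulr_sumr.
    by apply: eq_bigr => i _; rewrite -[u i *+ _]mulr_natr; ring.
  rewrite rmorphM rmorph_sum /= /Phi coef_sum; rewrite (eq_bigr _ (fun j _ => cj j)).
  rewrite -mulr_sumr exchange_big /=; congr (_ * _); apply: eq_bigr => i _.
  by rewrite -(uP i).2 mulr_sumr.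
have Phi_le t : cmod t = 1 -> cmod Phi.[t] <= expR 1 * supnorm c.
  move=> t1; have -> : Phi.[t] = hpoly_eval c (fun i => z i * (1 + x i * t)).
    rewrite horner_sum; apply: eq_bigr => j _; rewrite hornerM hornerC -mulrA; congr (_ * _).
    rewrite horner_prod big_tuple -big_split /=; apply: eq_bigr => k _.
    by rewrite hornerD hornerM hornerX -polyC1 !hornerC.
  (* Homogeneity on the polydisc of radius 1 + 1/m, followed by (1 + 1/m)^m <= e. *)
  apply: (@le_trans _ _ ((1 + r) ^+ m * supnorm c)).
    apply: hpoly_eval_le => [|i]; first by rewrite addr_gt0.
    rewrite cmodM z1 mul1r (le_trans (ler_cmodD _ _)) // cmod1 lerD2l.
    by rewrite !cmodM t1 (uP i).1 cmod_real !mulr1 gtr0_norm.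
  rewrite ler_wpM2r ?supnorm_ge0 //.
  have -> : expR 1 = expR r ^+ m :> R by rewrite -expRM_natl mulr_natl /r -mulr_natl divff
      // pnatr_eq0 -lt0n.
  by rewrite lerXn2r ?nnegrE ?expR_ge0 ?expR_ge1Dx // addr_ge0 // ltW.
have F0 : 0 <= \sum_i cmod (f i) by apply: sumr_ge0 => i _; exact: cmod_ge0.
have := parseval_le 2 Phi_le.
rewrite big_ord_recr /= big_ord1 Phi1 cmod_real ger0_norm ?mulr_ge0 ?(ltW r0) // => h.
have {h} : (r * \sum_i cmod (f i)) ^+ 2 <= (expR 1 * supnorm c) ^+ 2.
  by apply: le_trans h; rewrite lerDr sqr_ge0.
rewrite ler_sqr ?nnegrE ?mulr_ge0 ?expR_ge0 ?supnorm_ge0 ?(ltW r0) //.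
by rewrite /r ler_pdivrMl ?ltr0n // mulrA.
Qed.

(** [hypercontractive_family] for the family z_i dP/dz_i. By homogeneity every weight is 2^-m,
    whence the factor sqrt 2 ^ m; the coefficient of z_i dP/dz_i at [j] is [c j] times the
    multiplicity of [i], which is at least 1 when [i] occurs. *)
Lemma sum_slices_le : (0 < m)%N ->
  \sum_i Num.sqrt (\sum_(j : m.-tuple 'I_n | inJ j && (i \in j)) cmod (c j) ^+ 2)
  <= Num.sqrt 2 ^+ m * (m%:R * expR 1 * supnorm c).
Proof.
move=> m0.
pose e j i := count (fun x : 'I_n => x == i :> nat) j.
have eE j (i : 'I_n) : e j i = count_mem i j by apply: eq_count => x; rewrite /= val_eqE.
have se j : (\sum_(i < n) e j i)%N = m.
  transitivity (\sum_(x <- j) 1)%N; last by rewrite big_const_seq count_predT iter_addn_0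
      mul1n size_tuple.
  rewrite [RHS](sum_count_mem j (fun=> 1%N)); apply: eq_bigr => i _; rewrite eE.
  by rewrite -[LHS]muln1 mulnC -mulr_natr natn.
pose a (i : 'I_n) j : R[i] := if inJ j then c j * (count_mem i j)%:R else 0.
have := @hypercontractive_family R n _ _ a e (m%:R * expR 1 * supnorm c).
have s20 : 0 < Num.sqrt 2 ^+ m :> R by rewrite exprn_gt0 // sqrtr_gt0.
rewrite -(ler_pM2l s20) => h; apply: le_trans (h _ _) => {h}; first 1 last.
- move=> i j j'; rewrite /a; case: ifP; last by rewrite eqxx.
  move=> sj _; case: ifP; last by rewrite eqxx.
  move=> sj' _ jj'; apply: inJ_count_inj => // k; rewrite -!eE; exact: jj'.
- move=> z z1; apply: le_trans (sum_cmod_partials_le (z := fun i => z i) m0 (fun i => z1 i)).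
  apply: ler_sum => i _; rewrite [in leRHS]big_mkcond /= le_eqVlt; apply/orP; left; apply/eqP.
  congr cmod; apply: eq_bigr => j _; rewrite /a; case: ifP; rewrite ?mul0r // => _; congr (_
      * _).
  rewrite -(big_tuple _ _ j xpredT (fun x : 'I_n => z x)) (prod_count_mem j (fun x => z x)).
  by apply: eq_bigr => k _; rewrite eE.
rewrite mulr_sumr; apply: ler_sum => i _.
have -> : Num.sqrt 2 ^+ m = Num.sqrt (2 ^+ m) :> R.
  by apply: (@pexpIrn _ 2); rewrite ?nnegrE ?exprn_ge0 ?sqrtr_ge0 // exprAC !sqr_sqrtr
      ?exprn_ge0.
rewrite -sqrtrM ?exprn_ge0 //.
have a0 : 0 <= 2 ^+ m * \sum_j 2 ^- (\sum_(k < n) e j k) * cmod (a i j) ^+ 2.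
  by rewrite mulr_ge0 ?exprn_ge0 // sumr_ge0 // => j _; rewrite mulr_ge0 ?sqr_ge0 //
      invr_ge0 exprn_ge0.
rewrite ler_sqrt // mulr_sumr [leLHS]big_mkcond /=; apply: ler_sum => j _.
rewrite se mulrA divff ?expf_neq0 ?pnatr_eq0 // mul1r /a.
case: ifP => [/andP[-> ij]|_]; last exact: sqr_ge0.
rewrite cmodM exprMn ler_peMr ?sqr_ge0 // exprn_ege1 //.
rewrite -(rmorph_nat (@real_complex R)) cmod_real ger0_norm // ler1n.
by rewrite -has_count has_pred1.
Qed.
End HomogeneousPolynomials.

(** * The Lorentz norm *)

Section Rearrangement.
Context {R : realType}.

(** Abel summation. The boundary term in [main] multiplies [h N] by a nonpositive quantity, so
    passing to the smaller [h N.+1] only raises the bound. *)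
Lemma sum_thin_le (M : nat) (h : nat -> R) (B : pred nat) (del : R) :
  (forall N, 0 <= h N) -> (forall N, h N.+1 <= h N) ->
  (forall N, (N <= M)%N -> (\sum_(k < N | B k) 1 : R) <= del * N%:R) ->
  \sum_(k < M | B k) h k <= del * \sum_(k < M) h k.
Proof.
move=> h0 hS thin.
suff main N : (N <= M)%N -> \sum_(k < N | B k) h k
    <= del * (\sum_(k < N) h k) + h N * ((\sum_(k < N | B k) 1) - del * N%:R).
  apply: le_trans (main M (leqnn M)) _.
  by rewrite -[leRHS]addr0 lerD2l mulr_ge0_le0 // subr_le0 thin.
elim: N => [|N IH] NM; first by rewrite !big_ord0; lra.
have {IH} := IH (ltnW NM); have := thin _ NM; have := hS N.
have recr (F : nat -> R) : \sum_(k < N.+1 | B k) F k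
    = \sum_(k < N | B k) F k + (if B N then F N else 0).
  by rewrite big_mkcond big_ord_recr /= -big_mkcond.
rewrite (recr h) (recr (fun=> 1)) big_ord_recr /= -[N.+1%:R]natr1.
move: (\sum_(k < N | B k) h k) (\sum_(k < N) h k) (\sum_(k < N | B k) (1 : R)) => S T U.
case: (B N) => hh tt ii.
  have := mulr_ge0 (etrans (subr_ge0 _ _) hh) (etrans (subr_ge0 _ _) tt); lra.
rewrite !addr0 in tt *.
have := mulr_ge0 (etrans (subr_ge0 _ _) hh) (etrans (subr_ge0 _ _) tt); lra.
Qed.

(** * Increments of N^(1/m) and the Lorentz weights *)

Section Weights.
Variable m : nat.
Hypothesis m0 : (0 < m)%N.

Let root (k : nat) : R := k%:R `^ m%:R^-1.

Definition increment (k : nat) : R := root k.+1 - root k.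

(** The exponent is 1/p - 1 for p = 2m/(m+1). It makes the square comparable to [increment], as
    Cauchy-Schwarz on slices requires. *)
Definition decay (k : nat) : R := k.+1%:R `^ ((1 - m%:R) / (2 * m%:R)).

Lemma rootK k : root k ^+ m = k%:R.
Proof. by rewrite -powR_mulrn ?powR_ge0 // -powRrM mulVf ?powRr1 // pnatr_eq0 -lt0n. Qed.

Lemma root_le k k' : (k <= k')%N -> root k <= root k'.
Proof.
move=> kk'; rewrite /root ge0_ler_powR ?nnegrE ?invr_ge0 ?ler0n //.
by rewrite ler_nat.
Qed.

Lemma increment_ge0 k : 0 <= increment k.
Proof. by rewrite subr_ge0 root_le. Qed.

Lemma sum_increment N : \sum_(k < N) increment k = root N.
Proof.
elim: N => [|N IH]; last by rewrite big_ord_recr /= IH addrC subrK.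
by rewrite big_ord0 /root powR0 // invr_eq0 pnatr_eq0 -lt0n.
Qed.

Lemma decay_gt0 k : 0 < decay k.
Proof. by rewrite powR_gt0 // ltr0n. Qed.

Lemma decay_decr k : decay k.+1 <= decay k.
Proof.
have E j : decay j = (j.+1%:R `^ ((m%:R - 1) / (2 * m%:R)))^-1.
  by rewrite -powRN /decay -mulNr opprB.
rewrite !E lef_pV2 ?posrE ?powR_gt0 ?ltr0n //.
apply: ge0_ler_powR; rewrite ?nnegrE ?ler0n ?ler_nat //.
by rewrite divr_ge0 ?mulr_ge0 ?ler0n // subr_ge0 ler1n.
Qed.

Lemma decay_sqr k : decay k ^+ 2 = (root k.+1 ^+ m.-1)^-1.
Proof.
have mR : (m%:R : R) != 0 by rewrite pnatr_eq0 -lt0n.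
rewrite -powR_mulrn ?powR_ge0 // -powRrM -powR_mulrn ?powR_ge0 // -powRrM -powRN.
congr (_ `^ _); rewrite -subn1 natrB //; field.
by rewrite mR.
Qed.

(* [a^m - b^m <= m a^(m-1) (a - b)] with [a^m = k + 1] and [b^m = k]. *)
Lemma decay_sqr_le k : decay k ^+ 2 <= m%:R * increment k.
Proof.
have a0 : 0 < root k.+1 by rewrite powR_gt0 // ltr0n.
rewrite decay_sqr -[leLHS]mul1r ler_pdivrMr ?exprn_gt0 //.
have one : root k.+1 ^+ m - root k ^+ m = 1 by rewrite !rootK -natr1 addrAC subrr add0r.
rewrite -[leLHS]one subrXX mulrC [leRHS]mulrAC -/(increment k) ler_wpM2r ?increment_ge0 //.
rewrite mulr_natl -[X in _ *+ X]card_ord -sumr_const; apply: ler_sum => i _.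
have b0 : 0 <= root k by exact: powR_ge0.
have ba : root k <= root k.+1 by exact: root_le.
apply: (@le_trans _ _ (root k.+1 ^+ (m.-1 - i) * root k.+1 ^+ i)).
  rewrite ler_wpM2l ?exprn_ge0 ?(ltW a0) //.
  by rewrite lerXn2r ?nnegrE // ltW.
by rewrite -exprD subnK // -ltnS prednK.
Qed.

(* [x^(1/p) = x * x^(1/p - 1)], where [1/p - 1 = (1 - m)/(2m) <= 0]. *)
Lemma lorentz_weight_le k (p := (2 * m%:R) / (m%:R + 1) : R) :
  k.+1%:R `^ p^-1 - k%:R `^ p^-1 <= decay k.
Proof.
have mR : (m%:R : R) != 0 by rewrite pnatr_eq0 -lt0n.
have m1 : (1 : R) <= m%:R by rewrite ler1n.
have pE : p^-1 = 1 + (1 - m%:R) / (2 * m%:R).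
  by rewrite /p; field; rewrite mR /= gt_eqF // ltr_wpDl // ler0n.
have split N : N.+1%:R `^ p^-1 = N.+1%:R * decay N.
  by rewrite pE powRD ?powRr1 ?ler0n //; apply/implyP => _; rewrite pnatr_eq0.
rewrite split; case: k => [|k].
  by rewrite mul1r lerBlDl lerDr powR_ge0.
rewrite split -natr1 mulrDl mul1r addrAC -lerBrDr subrr subr_le0.
by rewrite ler_wpM2l ?ler0n // decay_decr.
Qed.
End Weights.
End Rearrangement.

(** * Good and bad indices along the decreasing enumeration *)

Section LorentzBlei.
Context {R : realType}.

(** If the last index is counted, the whole partial sum up to it is already at most [b]. *)
Lemma sum_capped_le (w : nat -> R) (b : R) M : (forall N, 0 <= w N) -> 0 <= b ->
  \sum_(N < M | \sum_(k < N.+1) w k <= b) w N <= b.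
Proof.
move=> w0 b0; elim: M => [|M IH]; first by rewrite big_ord0.
rewrite big_mkcond big_ord_recr /= -big_mkcond /=.
case: (leP (\sum_(k < M.+1) w k) b) => [wb|_]; last by rewrite addr0.
apply: le_trans wb; rewrite big_ord_recr /= lerD2r big_mkcond /=.
by apply: ler_sum => N _; case: ifP.
Qed.

Lemma sum_inj_le (I J : finType) (P : pred I) (f : I -> J) (G : J -> R) :
  injective f -> (forall j, 0 <= G j) -> \sum_(i | P i) G (f i) <= \sum_j G j.
Proof.
move=> finj G0; rewrite -(big_imset (h := f) (A := P)) /=; last by move=> i i' _ _ /finj.
rewrite [leRHS](bigID (fun j => j \in f @: P)) /= lerDl.
by apply: sumr_ge0.
Qed.

Variables (m n : nat).
Hypothesis m0 : (0 < m)%N.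
Variables (t0 : m.-tuple 'I_n) (s : seq (m.-tuple 'I_n)) (x : m.-tuple 'I_n -> R).
Hypothesis s_uniq : uniq s.
Hypothesis x_ge0 : forall j, 0 <= x j.
Hypothesis x_decr : sorted (fun a b : R => b <= a) (map x s).

Let M := size s.
Let y (N : nat) := nth t0 s N.

Let slice_mass (N : nat) (k : 'I_m) (i : 'I_n) : R :=
  \sum_(N' < N | tnth (y N') k == i) increment m N'.

(** [N.+1] makes the mass include the index [N] itself, as in [sum_capped_le]. *)
Let good N (k : 'I_m) : bool := slice_mass N.+1 k (tnth (y N) k) <= 2.

Let bad N : bool := ~~ [exists k, good N k].

Lemma slice_mass_ge0 N k i : 0 <= slice_mass N k i.
Proof. by apply: sumr_ge0 => N' _; exact: increment_ge0. Qed.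

Lemma slice_mass_le N N' k i : (N <= N')%N -> slice_mass N k i <= slice_mass N' k i.
Proof.
move=> NN'; rewrite /slice_mass !(big_mkcond (fun _ => _ == i)) /=.
rewrite (big_ord_widen N' (fun N0 => if tnth (y N0) k == i then increment m N0 else 0) NN').
rewrite big_mkcond /=; apply: ler_sum => l _; case: ifP => // _.
by case: ifP => // _; exact: increment_ge0.
Qed.

Lemma sum_slice_mass N k : \sum_i slice_mass N k i = N%:R `^ m%:R^-1.
Proof.
rewrite -(sum_increment m0).
by rewrite [RHS](partition_big (fun N' : 'I_N => tnth (y N') k) xpredT).
Qed.

(* Loomis-Whitney: the product over the directions of the masses of the slices
   through a bad point exceeds [2 ^ m], while its sum over the whole grid is the
   product of the total masses. *)
Lemma bad_thin N : (N <= M)%N -> (\sum_(N' < N | bad N') 1 : R) <= 2^-1 * N%:R.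
Proof.
move=> NM.
pose G (f : {ffun 'I_m -> 'I_n}) : R := \prod_k (slice_mass N k (f k) / 2).
have G0 f : 0 <= G f by apply: prodr_ge0 => k _; rewrite divr_ge0 ?slice_mass_ge0.
pose g (N' : 'I_N) := [ffun k => tnth (y N') k].
have g_inj : injective g.
  move=> N1 N2 /ffunP g12; apply/val_inj/eqP.
  rewrite -(nth_uniq t0 _ _ s_uniq) ?(leq_trans (ltn_ord _) NM) //.
  by apply/eqP/eq_from_tnth => k; have := g12 k; rewrite !ffunE.
apply: (@le_trans _ _ (\sum_(N' < N | bad N') G (g N'))).
  apply: ler_sum => N' /existsPn badN'.
  rewrite -[leLHS](_ : \prod_(k < m) 1 = 1); last by rewrite big1.
  apply: ler_prod => k _; rewrite ler01 ler_pdivlMr // mul1r ffunE /=.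
  have := badN' k; rewrite /good -ltNge => /ltW /le_trans; apply.
  exact: slice_mass_le.
apply: le_trans (sum_inj_le _ g_inj G0) _.
rewrite /G -(bigA_distr_bigA (fun k i => slice_mass N k i / 2)) /=.
under eq_bigr do rewrite -mulr_suml sum_slice_mass.
(* The product of the [m] halved total masses is N / 2^m, at most N / 2 because [m] is positive. *)
rewrite prodr_const card_ord exprMn rootK // mulrC ler_wpM2r // exprVn.
by rewrite lef_pV2 ?posrE ?exprn_gt0 // -[leLHS]expr1 ler_weXn2l // ler1n.
Qed.

Let h (N : nat) : R := nth 0 (map x s) N * decay m N.

Lemma h_ge0 N : 0 <= h N.
Proof.
rewrite mulr_ge0 ?(ltW (decay_gt0 _ _)) //.
case: (ltnP N M) => NM; first by rewrite (nth_map t0).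
by rewrite nth_default // size_map.
Qed.

Lemma h_decr N : h N.+1 <= h N.
Proof.
have xN : forall N, 0 <= nth 0 (map x s) N.
  move=> k; case: (ltnP k M) => kM; first by rewrite (nth_map t0).
  by rewrite nth_default // size_map.
apply: ler_pM; rewrite ?xN ?(ltW (decay_gt0 _ _)) ?decay_decr //.
case: (ltnP N.+1 M) => NM; last by rewrite nth_default ?size_map.
by have /sortedP/(_ N) := x_decr; rewrite size_map; apply.
Qed.

Let slice_norm (k : 'I_m) (i : 'I_n) : R :=
  Num.sqrt (\sum_(j <- s | tnth j k == i) x j ^+ 2).

(** Cauchy-Schwarz separates [x] from [decay]. The squares of [decay] are at most [m] times the
    increments, and the increments at good indices of one slice add up to at most 2. *)
Lemma good_slice_le k i :
  \sum_(N < M | (tnth (y N) k == i) && good N k) h N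
  <= Num.sqrt (2 * m%:R) * slice_norm k i.
Proof.
apply: le_trans (sum_mul_le_sqrt _ _ (fun N : 'I_M => nth 0 (map x s) N)
  (fun N : 'I_M => decay m N)) _.
rewrite mulrC ler_pM ?sqrtr_ge0 //; apply: ler_wsqrtr.
  apply: (@le_trans _ _ (m%:R * \sum_(N < M | (tnth (y N) k == i) && good N k) increment m N)).
    by rewrite mulr_sumr; apply: ler_sum => N _; exact: decay_sqr_le.
  rewrite mulrC ler_wpM2r //.
  (* Zero off the slice, so that the partial sums of [w] are the slice masses. *)
  pose w N : R := if tnth (y N) k == i then increment m N else 0.
  have w0 N : 0 <= w N by rewrite /w; case: ifP => // _; exact: increment_ge0.
  apply: le_trans (sum_capped_le M w0 (ler0n _ 2)).
  rewrite big_mkcond [leRHS]big_mkcond /=; apply: ler_sum => N _.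
  rewrite {2}/w /good /slice_mass; case: eqP => [->|_] /=; last by case: ifP.
  by rewrite big_mkcond.
rewrite [leRHS](big_nth t0) big_mkord [leRHS]big_mkcond [leLHS]big_mkcond /=.
apply: ler_sum => N _; rewrite (nth_map t0) // -/(y N).
by case: eqP => //= _; case: ifP => // _; rewrite sqr_ge0.
Qed.

(** The bad indices carry at most half of the whole sum, so the whole is at most twice the good
    part; each good index is charged to a direction in which it is good. *)
Lemma sum_decay_le :
  \sum_(N < M) nth 0 (map x s) N * decay m N
  <= 2 * (Num.sqrt (2 * m%:R) * \sum_k \sum_i slice_norm k i).
Proof.
rewrite -/(h _) (bigID (fun N : 'I_M => bad N)) /=.
have := sum_thin_le h_ge0 h_decr bad_thin.
rewrite [X in _ <= _ * X](bigID (fun N : 'I_M => bad N)) /=.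
have : \sum_(N < M | ~~ bad N) h N <= Num.sqrt (2 * m%:R) * \sum_k \sum_i slice_norm k i.
  apply: (@le_trans _ _ (\sum_(N < M) \sum_k (if good N k then h N else 0))).
    rewrite big_mkcond /=; apply: ler_sum => N _; rewrite negbK.
    case: existsP => [[k gk]|_]; last first.
      by apply: sumr_ge0 => k _; case: ifP => // _; exact: h_ge0.
    rewrite (bigD1 k) //= gk lerDl; apply: sumr_ge0 => l _.
    by case: ifP => // _; exact: h_ge0.
  rewrite exchange_big mulr_sumr; apply: ler_sum => k _ /=.
  rewrite -big_mkcond (partition_big (fun N : 'I_M => tnth (y N) k) xpredT) //= mulr_sumr.
  apply: ler_sum => i _; apply: le_trans (good_slice_le k i).
  by under eq_bigl do rewrite andbC.
by move: (\sum_(N < M | bad N) h N) (\sum_(N < M | ~~ bad N) h N) => a b; lra.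
Qed.
End LorentzBlei.

(** * Combining the estimates *)

Lemma coef_lorentz_le (R : realType) (m n : nat) (c : m.-tuple 'I_n -> R[i]) :
  (0 < m)%N -> coef_lorentz (2 * m%:R / (m%:R + 1)) c
  <= (4 * expR 1 * m%:R ^+ 3 * Num.sqrt 2 ^+ m) * supnorm c.
Proof.
move=> m0; rewrite /coef_lorentz /lorentz_p1.
set J := enum _; set x := fun j => cmod (c j); rewrite sort_map.
set ge_x := relpre _ _; set s := sort ge_x J.
have rhs0 : 0 <= (4 * expR 1 * m%:R ^+ 3 * Num.sqrt 2 ^+ m) * supnorm c.
  by rewrite !mulr_ge0 ?exprn_ge0 ?supnorm_ge0 ?expR_ge0 ?sqrtr_ge0.
(* A default tuple for [nth] exists unless there are no coefficients, in which case the norm is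
   0. *)
have [s0|[t0 _]] : s = [::] \/ exists t0 : m.-tuple 'I_n, True.
  by case: s => [|t0 ?]; [left|right; exists t0].
  by rewrite s0 big_ord0.
have s_uniq : uniq s by rewrite sort_uniq enum_uniq.
have x0 j : 0 <= x j by exact: cmod_ge0.
have x_decr : sorted (fun a b : R => b <= a) (map x s).
  by rewrite sorted_map; apply: sort_sorted => a b; exact: le_total.
apply: (@le_trans _ _ (\sum_(N < size s) nth 0 (map x s) N * decay m N)).
  rewrite size_map; apply: ler_sum => N _; apply: ler_wpM2l; last exact: lorentz_weight_le.
  by rewrite (nth_map t0) ?cmod_ge0.
apply: le_trans (sum_decay_le m0 t0 s_uniq x0 x_decr) _.
set B := Num.sqrt 2 ^+ m * (m%:R * expR 1 * supnorm c).
(* The slice j_k = i lies in the set of [j] containing [i], so one bound serves all directions. *)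
have slices (k : 'I_m) : \sum_i Num.sqrt (\sum_(j <- s | tnth j k == i) x j ^+ 2) <= B.
  apply: le_trans (sum_slices_le c m0); apply: ler_sum => i _; apply: ler_wsqrtr.
  rewrite (perm_big J) ?perm_sort //= big_enum_cond /= big_mkcond [leRHS]big_mkcond /=.
  apply: ler_sum => j _; rewrite -[j \in _]/(inJ j); case: (inJ j) => //=.
  by case: eqP => [<-|_]; [rewrite mem_tnth|case: ifP; rewrite ?sqr_ge0].
have B0 : 0 <= B by rewrite !mulr_ge0 ?exprn_ge0 ?supnorm_ge0 ?expR_ge0 ?sqrtr_ge0.
have s2m : Num.sqrt (2 * m%:R) <= 2 * m%:R :> R.
  rewrite -[leRHS]ger0_norm ?mulr_ge0 // -sqrtr_sqr; apply: ler_wsqrtr.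
  by rewrite expr2 ler_peMr ?mulr_ge0 // -natrM ler1n muln_gt0.
(* Factors: 2 for the bad indices, 2m above sqrt(2m), m directions, and m e sqrt 2 ^ m inside
   [B]. *)
apply: (@le_trans _ _ (2 * (2 * m%:R * (m%:R * B)))); last first.
  by rewrite /B le_eqVlt; apply/orP; left; apply/eqP; ring.
rewrite ler_pM2l // ler_pM ?sqrtr_ge0 //.
  by apply: sumr_ge0 => k _; apply: sumr_ge0 => i _; exact: sqrtr_ge0.
apply: (@le_trans _ _ (\sum_(k < m) B)); first by apply: ler_sum.
by rewrite sumr_const card_ord mulr_natl.
Qed.

Theorem theorem5p2 (R : realType) (eps : R) (heps : 0 < eps) :
  exists C : R, 0 < C /\
    forall m : nat, (1 <= m)%N ->
      (BHpol_lorentz ((2 * m%:R) / (m%:R + 1)) m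
         <= ((C * (Num.sqrt 2 + eps) ^+ m)%:E))%E.
Proof.
have s20 : 0 < Num.sqrt 2 :> R by rewrite sqrtr_gt0.
pose del := eps / Num.sqrt 2.
have del0 : 0 < del by rewrite divr_gt0.
(* For t <= 1, (1 + t)^3 - 1 = 3t + 3t^2 + t^3 <= 7t. *)
pose sg := Num.min 1 (del / 7).
have sg0 : 0 < sg by rewrite lt_min ltr01 divr_gt0.
have sg_del : (1 + sg) ^+ 3 <= 1 + del.
  have : sg <= 1 by rewrite ge_min lexx.
  have : sg <= del / 7 by rewrite ge_min lexx orbT.
  move: sg sg0 => t t0 td t1.
  have t2 : t ^+ 2 <= t by rewrite expr2 ler_piMr // ltW.
  have t3 : t ^+ 3 <= t by rewrite exprS (le_trans _ t2) // expr2 ler_pM2l.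
  have -> : (1 + t) ^+ 3 = 1 + (3 * t + 3 * t ^+ 2 + t ^+ 3) by ring.
  lra.
have E0 := expR_gt0 (1 : R).
exists (4 * expR 1 / sg ^+ 3); split; first by rewrite divr_gt0 ?mulr_gt0 ?exprn_gt0.
move=> m m0; pose Cm : R := 4 * expR 1 * m%:R ^+ 3 * Num.sqrt 2 ^+ m.
have m1 : (1 : R) <= m%:R by rewrite ler1n.
(* The polynomial factor is absorbed by the Bernoulli-type bound m sg <= (1 + sg)^m, cubed. *)
have cube : m%:R ^+ 3 <= (1 + del) ^+ m / sg ^+ 3 :> R.
  rewrite ler_pdivlMr ?exprn_gt0 // -exprMn.
  apply: (@le_trans _ _ (((1 + sg) ^+ m) ^+ 3)); last first.
    by rewrite exprAC lerXn2r ?nnegrE ?exprn_ge0 ?addr_ge0 ?(ltW sg0) ?(ltW del0).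
  rewrite lerXn2r ?nnegrE ?mulr_ge0 ?exprn_ge0 ?addr_ge0 ?(ltW sg0) //.
  elim: m {m0 Cm m1} => [|k IH]; first by rewrite mul0r.
  rewrite -natr1 mulrDl mul1r exprS mulrDl mul1r lerD //.
  by rewrite ler_peMr ?(ltW sg0) // exprn_ege1 // lerDl ltW.
apply: (@le_trans _ _ Cm%:E).
  (* Admissible constants must also be at least 1, which is checked factor by factor. *)
  apply: ereal_inf_lbound; exists Cm => //; split; last by move=> n c; exact: coef_lorentz_le.
  rewrite /Cm -[leLHS]mulr1; apply: ler_pM => //.
    rewrite -[leLHS]mulr1; apply: ler_pM => //; last by rewrite exprn_ege1.
    by have := expR_ge1Dx (1 : R); lra.
  by rewrite exprn_ege1 // -[leLHS]sqrtr1 ler_wsqrtr // ler1n.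
rewrite lee_fin /Cm.
have -> : Num.sqrt 2 + eps = Num.sqrt 2 * (1 + del).
  by rewrite mulrDr mulr1 /del mulrCA divff ?mulr1 // gt_eqF.
rewrite exprMn.
have -> : 4 * expR 1 / sg ^+ 3 * (Num.sqrt 2 ^+ m * (1 + del) ^+ m)
  = 4 * expR 1 * ((1 + del) ^+ m / sg ^+ 3) * Num.sqrt 2 ^+ m by ring.
by rewrite ler_pM2r ?exprn_gt0 // ler_pM2l ?mulr_gt0.
Qed.
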